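(* Let $\mathbb C$ be a semi-abelian category. Let $f\colon X'\to X$, $g\colon Y'\to Y$, $h\colon W'\to W$, $\alpha\colon A'\to A$ be normal epimorphisms and $x\colon X\to A$, $y\colon Y\to A$, $w\colon W\to A$, $x'\colon X'\to A'$, $y'\colon Y'\to A'$, $w'\colon W'\to A'$ morphisms with $xf=\alpha x'$, $yg=\alpha y'$, $wh=\alpha w'$. Then the morphisms $[(X',x'),(Y',y')]_{(W',w')}\to[(X,x),(Y,y)]_{(W,w)}$ and $N[(X',x'),(Y',y')]_{(W',w')}\to N[(X,x),(Y,y)]_{(W,w)}$ induced by $\alpha$ are normal epimorphisms. In particular, the same holds for the induced morphisms between the $0$-weighted subobject commutators, the $0$-weighted normal commutators, the $1$-weighted subobject commutators and the $1$-weighted normal commutators.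
   Context: A semi-abelian category is a pointed, Barr-exact, Bourn-protomodular category with binary coproducts. Notation: $\iota_i$ coproduct injections, $[a,b,c]$ copairing, $\langle a,b\rangle$ pairing; $(W+X)\times_W(W+Y)$ is the pullback of $[1,0]\colon W+X\to W$ and $[1,0]\colon W+Y\to W$; $q=\langle [\iota_1,\iota_2,0],[\iota_1,0,\iota_2]\rangle\colon W+X+Y\to (W+X)\times_W(W+Y)$. The $(W,w)$-weighted subobject commutator $[(X,x),(Y,y)]_{(W,w)}\to A$ is the image (in the (regular epi, mono) factorization) under $[w,x,y]\colon W+X+Y\to A$ of the kernel of $q$; the $(W,w)$-weighted normal commutator $N[(X,x),(Y,y)]_{(W,w)}\to A$ is the kernel of $\nu\colon A\to\tilde C$, where $(\nu,\mu)$ is the pushout of $q$ and $[w,x,y]$. The $0$-weighted versions are those with $(W,w)=(0,0\colon 0\to A)$ (and $(W',w')=(0,0)$, $h=1_0$), and the $1$-weighted versions are those with $(W,w)=(A,1_A)$ (and $(W',w')=(A',1_{A'})$, $h=\alpha$). The induced morphism between commutators is the unique morphism $\varphi$ with $\kappa\varphi=\alpha\kappa'$, where $\kappa,\kappa'$ are the commutator subobjects of $A$ and $A'$. *)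

(* Defs.v *)
Set Implicit Arguments.
Unset Strict Implicit.

Record Category := {
  Ob :> Type;
  Hom : Ob -> Ob -> Type;
  idm : forall A, Hom A A;
  comp : forall A B D, Hom B D -> Hom A B -> Hom A D;
  comp_assoc : forall A B D E (h : Hom D E) (g : Hom B D) (f : Hom A B),
      comp h (comp g f) = comp (comp h g) f;
  comp_id_l : forall A B (f : Hom A B), comp (idm B) f = f;
  comp_id_r : forall A B (f : Hom A B), comp f (idm A) = f }.

Arguments Hom {c} A B.
Arguments idm {c} A.
Arguments comp {c A B D} _ _.
Notation "g ∘ f" := (comp g f) (at level 40, left associativity).

Section Defs.
Context {C : Category}.

Definition mono {A B : C} (m : Hom A B) :=
  forall (Z : C) (a b : Hom Z A), m ∘ a = m ∘ b -> a = b.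
Definition iso {A B : C} (f : Hom A B) :=
  exists g : Hom B A, g ∘ f = idm A /\ f ∘ g = idm B.
Definition is_initial (I : C) := forall A : C, exists! f : Hom I A, True.
Definition is_terminal (T : C) := forall A : C, exists! f : Hom A T, True.
Definition is_zero_obj (Z : C) := is_initial Z /\ is_terminal Z.
Definition is_zero_mor {A B : C} (f : Hom A B) :=
  exists (Z : C) (u : Hom A Z) (v : Hom Z B), is_zero_obj Z /\ f = v ∘ u.

Definition is_pullback {A B D P : C} (f : Hom A D) (g : Hom B D)
    (p1 : Hom P A) (p2 : Hom P B) :=
  f ∘ p1 = g ∘ p2 /\
  forall (Q : C) (q1 : Hom Q A) (q2 : Hom Q B), f ∘ q1 = g ∘ q2 ->
    exists! u : Hom Q P, p1 ∘ u = q1 /\ p2 ∘ u = q2.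
Definition is_pushout {D A B P : C} (f : Hom D A) (g : Hom D B)
    (p1 : Hom A P) (p2 : Hom B P) :=
  p1 ∘ f = p2 ∘ g /\
  forall (Q : C) (q1 : Hom A Q) (q2 : Hom B Q), q1 ∘ f = q2 ∘ g ->
    exists! u : Hom P Q, u ∘ p1 = q1 /\ u ∘ p2 = q2.
Definition is_kernel {K A B : C} (f : Hom A B) (k : Hom K A) :=
  is_zero_mor (f ∘ k) /\
  forall (Z : C) (z : Hom Z A), is_zero_mor (f ∘ z) -> exists! u : Hom Z K, k ∘ u = z.
Definition is_cokernel {K A Q : C} (k : Hom K A) (q : Hom A Q) :=
  is_zero_mor (q ∘ k) /\
  forall (Z : C) (z : Hom A Z), is_zero_mor (z ∘ k) -> exists! u : Hom Q Z, u ∘ q = z.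
Definition normal_epi {A Q : C} (q : Hom A Q) := exists (K : C) (k : Hom K A), is_cokernel k q.
Definition is_coequalizer {R A Q : C} (a b : Hom R A) (q : Hom A Q) :=
  q ∘ a = q ∘ b /\
  forall (Z : C) (z : Hom A Z), z ∘ a = z ∘ b -> exists! u : Hom Q Z, u ∘ q = z.
Definition regular_epi {A Q : C} (q : Hom A Q) :=
  exists (R : C) (a b : Hom R A), is_coequalizer a b q.
Definition is_coproduct {A B S : C} (i1 : Hom A S) (i2 : Hom B S) :=
  forall (Z : C) (f : Hom A Z) (g : Hom B Z),
    exists! u : Hom S Z, u ∘ i1 = f /\ u ∘ i2 = g.
Definition is_coproduct3 {A B D S : C} (i1 : Hom A S) (i2 : Hom B S) (i3 : Hom D S) :=
  forall (Z : C) (f : Hom A Z) (g : Hom B Z) (h : Hom D Z),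
    exists! u : Hom S Z, u ∘ i1 = f /\ u ∘ i2 = g /\ u ∘ i3 = h.

Definition pointed := exists Z : C, is_zero_obj Z.
Definition has_finite_limits :=
  (exists T : C, is_terminal T) /\
  forall (A B D : C) (f : Hom A D) (g : Hom B D),
    exists (P : C) (p1 : Hom P A) (p2 : Hom P B), is_pullback f g p1 p2.
Definition has_binary_coproducts :=
  forall A B : C, exists (S : C) (i1 : Hom A S) (i2 : Hom B S), is_coproduct i1 i2.
Definition is_kernel_pair {R A B : C} (f : Hom A B) (r1 r2 : Hom R A) :=
  is_pullback f f r1 r2.
Definition regular_category :=
  has_finite_limits /\
  (forall (A B : C) (f : Hom A B) (R : C) (r1 r2 : Hom R A),
      is_kernel_pair f r1 r2 -> exists (Q : C) (q : Hom A Q), is_coequalizer r1 r2 q) /\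
  (forall (A B D : C) (f : Hom A D) (g : Hom B D) (P : C) (p1 : Hom P A) (p2 : Hom P B),
      is_pullback f g p1 p2 -> regular_epi g -> regular_epi p1).
Definition jointly_monic {R A B : C} (r1 : Hom R A) (r2 : Hom R B) :=
  forall (Z : C) (a b : Hom Z R), r1 ∘ a = r1 ∘ b -> r2 ∘ a = r2 ∘ b -> a = b.
Definition equivalence_relation {R A : C} (r1 r2 : Hom R A) :=
  jointly_monic r1 r2 /\
  (exists d : Hom A R, r1 ∘ d = idm A /\ r2 ∘ d = idm A) /\
  (exists s : Hom R R, r1 ∘ s = r2 /\ r2 ∘ s = r1) /\
  (forall (P : C) (p1 p2 : Hom P R), is_pullback r2 r1 p1 p2 ->
     exists t : Hom P R, r1 ∘ t = r1 ∘ p1 /\ r2 ∘ t = r2 ∘ p2).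
Definition barr_exact :=
  regular_category /\
  forall (R A : C) (r1 r2 : Hom R A), equivalence_relation r1 r2 ->
    exists (B : C) (f : Hom A B), is_kernel_pair f r1 r2.
(* Bourn protomodularity: every change-of-base functor f^* : Pt(B) -> Pt(E)
   of the fibration of points reflects isomorphisms. *)
Definition protomodular :=
  forall (B E : C) (f : Hom E B) (A A' : C) (p : Hom A B) (s : Hom B A)
         (p' : Hom A' B) (s' : Hom B A') (g : Hom A A'),
    p ∘ s = idm B -> p' ∘ s' = idm B -> p' ∘ g = p -> g ∘ s = s' ->
    forall (P : C) (a : Hom P A) (e : Hom P E) (P' : C) (a' : Hom P' A') (e' : Hom P' E)
           (gb : Hom P P'),
      is_pullback p f a e -> is_pullback p' f a' e' ->
      a' ∘ gb = g ∘ a -> e' ∘ gb = e -> iso gb -> iso g.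

(* All data (any choice) defining the (W,w)-weighted subobject commutator
   [(X,x),(Y,y)]_(W,w) (subobject ckappa : cI -> A) and the weighted normal
   commutator N[(X,x),(Y,y)]_(W,w) (subobject nkappa : cN -> A). *)
Record wcomm_data (W X Y A : C) (w : Hom W A) (x : Hom X A) (y : Hom Y A) := {
  cS : C;
  ci1 : Hom W cS; ci2 : Hom X cS; ci3 : Hom Y cS;
  c_coprod : is_coproduct3 ci1 ci2 ci3;
  cWX : C; j1 : Hom W cWX; j2 : Hom X cWX; j_coprod : is_coproduct j1 j2;
  cWY : C; l1 : Hom W cWY; l2 : Hom Y cWY; l_coprod : is_coproduct l1 l2;
  rX : Hom cWX W; rX_1 : rX ∘ j1 = idm W; rX_2 : is_zero_mor (rX ∘ j2);
  rY : Hom cWY W; rY_1 : rY ∘ l1 = idm W; rY_2 : is_zero_mor (rY ∘ l2);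
  cP : C; pp1 : Hom cP cWX; pp2 : Hom cP cWY;
  P_pb : is_pullback rX rY pp1 pp2;
  q : Hom cS cP;
  q1_1 : pp1 ∘ q ∘ ci1 = j1; q1_2 : pp1 ∘ q ∘ ci2 = j2; q1_3 : is_zero_mor (pp1 ∘ q ∘ ci3);
  q2_1 : pp2 ∘ q ∘ ci1 = l1; q2_2 : is_zero_mor (pp2 ∘ q ∘ ci2); q2_3 : pp2 ∘ q ∘ ci3 = l2;
  cmap : Hom cS A;
  cmap_1 : cmap ∘ ci1 = w; cmap_2 : cmap ∘ ci2 = x; cmap_3 : cmap ∘ ci3 = y;
  cK : C; kq : Hom cK cS; kq_ker : is_kernel q kq;
  cI : C; ce : Hom cK cI; ckappa : Hom cI A;
  ce_reg : regular_epi ce; ckappa_mono : mono ckappa;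
  cfact : ckappa ∘ ce = cmap ∘ kq;
  cT : C; nu : Hom A cT; mu : Hom cP cT;
  po : is_pushout cmap q nu mu;
  cN : C; nkappa : Hom cN A; nker : is_kernel nu nkappa }.

Definition induced_normal_epis {W X Y A W' X' Y' A' : C}
    {w : Hom W A} {x : Hom X A} {y : Hom Y A}
    {w' : Hom W' A'} {x' : Hom X' A'} {y' : Hom Y' A'}
    (alpha : Hom A' A) (D : wcomm_data w x y) (D' : wcomm_data w' x' y') :=
  (exists phi : Hom (cI D') (cI D),
      ckappa D ∘ phi = alpha ∘ ckappa D' /\ normal_epi phi) /\
  (exists psi : Hom (cN D') (cN D),
      nkappa D ∘ psi = alpha ∘ nkappa D' /\ normal_epi psi).

End Defs.

Definition semi_abelian (C : Category) : Prop :=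
  @pointed C /\ @barr_exact C /\ @protomodular C /\ @has_binary_coproducts C.

(* Main.v *)
(** In a pointed regular protomodular category, a morphism of split epimorphisms whose two
    components are strong epimorphisms induces a strong epimorphism between the kernels.
    The kernel of [q] is an iterated kernel of split epimorphisms, so [ker q' -> ker q] is
    strong, and passing to images gives the subobject commutators. For the normal
    commutators, [q] is strong, hence the cokernel of its kernel, so that [ker nu] is the
    smallest kernel through which [[w,x,y]] restricted to [ker q] factors. By exactness the
    direct image of [ker nu'] along [alpha] is again a kernel; hence it is all of
    [ker nu]. *)

From Corelib Require Import ssreflect.
Require Import Defs.

Set Implicit Arguments.
Unset Strict Implicit.

Local Notation "h .1" := (proj1 h) (at level 1, left associativity, format "h .1").
Local Notation "h .2" := (proj2 h) (at level 1, left associativity, format "h .2").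

(** * Strong epimorphisms, pullbacks, coproducts and zero morphisms in any category *)

Section Generalities.
Context {C : Category}.

Lemma comp_reassoc {A B D : C} {g : Hom B D} {f : Hom A B} {k : Hom A D} :
  g ∘ f = k -> forall (Z : C) (z : Hom Z A), g ∘ (f ∘ z) = k ∘ z.
Proof. by move=> <- Z z; rewrite comp_assoc. Qed.

Definition epi {A B : C} (e : Hom A B) :=
  forall (Z : C) (a b : Hom B Z), a ∘ e = b ∘ e -> a = b.

(** The working notion of epimorphism: it composes and cancels in any category, and under the
    hypotheses of the theorem it agrees with regular and normal epimorphisms. Uniqueness of [t] is
    automatic, since [m] is monic. *)
Definition strong_epi {A B : C} (e : Hom A B) :=
  forall (M D : C) (m : Hom M D) (u : Hom A M) (v : Hom B D),
    mono m -> m ∘ u = v ∘ e -> exists t : Hom B M, t ∘ e = u /\ m ∘ t = v.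

Lemma mono_cancel {A B D : C} (m : Hom B D) (n : Hom A B) :
  mono (m ∘ n) -> mono n.
Proof. by move=> mm Z a b e; apply: mm; rewrite -!comp_assoc e. Qed.

Lemma strong_comp {A B D : C} (e : Hom B D) (f : Hom A B) :
  strong_epi e -> strong_epi f -> strong_epi (e ∘ f).
Proof.
move=> he hf M E m u v mm; rewrite comp_assoc => eq.
have [t [tf mt]] := hf _ _ _ _ _ mm eq.
have [r [re mr]] := he _ _ _ _ _ mm mt.
by exists r; split=> //; rewrite comp_assoc re.
Qed.

Lemma strong_cancel {A B D : C} (e : Hom B D) (f : Hom A B) :
  strong_epi (e ∘ f) -> strong_epi e.
Proof.
move=> hef M E m u v mm eq.
have [|t [te mt]] := hef _ _ m (u ∘ f) v mm.
  by rewrite !comp_assoc eq.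
exists t; split=> //; apply: mm.
by rewrite comp_assoc mt.
Qed.

Lemma strong_mono_iso {A B : C} (e : Hom A B) : strong_epi e -> mono e -> iso e.
Proof.
move=> he me; have [|t [te et]] := he _ _ e (idm A) (idm B) me.
  by rewrite comp_id_l comp_id_r.
by exists t.
Qed.

Lemma iso_strong {A B : C} (e : Hom A B) : iso e -> strong_epi e.
Proof.
move=> [i [ie ei]] M D m u v mm eq; exists (u ∘ i).
by rewrite -comp_assoc ie comp_id_r comp_assoc eq -comp_assoc ei comp_id_r.
Qed.

Lemma regular_epi_epi {A B : C} (e : Hom A B) : regular_epi e -> epi e.
Proof.
move=> [R [a [b [eab he]]]] Z u v uv.
have [|t [_ ht]] := he _ (v ∘ e); first by rewrite -!comp_assoc eab.
by rewrite -(ht u uv) -(ht v).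
Qed.

Lemma regular_strong {A B : C} (e : Hom A B) : regular_epi e -> strong_epi e.
Proof.
move=> he M D m u v mm eq; have epe := regular_epi_epi he.
case: he => R [a [b [eab he]]].
have [|t [te _]] := he _ u.
  by apply: mm; rewrite !comp_assoc eq -!comp_assoc eab.
by exists t; split=> //; apply: epe; rewrite -comp_assoc te.
Qed.

Lemma pb_lift {A B D P : C} {f : Hom A D} {g : Hom B D} {p1 : Hom P A} {p2 : Hom P B} :
  is_pullback f g p1 p2 ->
  forall (Q : C) (q1 : Hom Q A) (q2 : Hom Q B), f ∘ q1 = g ∘ q2 ->
  exists u : Hom Q P, p1 ∘ u = q1 /\ p2 ∘ u = q2.
Proof. by move=> [_ h] Q q1 q2 /h [u [hu _]]; exists u. Qed.

Lemma pb_ext {A B D P : C} {f : Hom A D} {g : Hom B D} {p1 : Hom P A} {p2 : Hom P B} :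
  is_pullback f g p1 p2 -> jointly_monic p1 p2.
Proof.
move=> [e h] Z a b e1 e2; have [|u [_ hu]] := h Z (p1 ∘ b) (p2 ∘ b).
  by rewrite !comp_assoc e.
by rewrite -(hu a) // -(hu b).
Qed.

Lemma pb_sym {A B D P : C} {f : Hom A D} {g : Hom B D} {p1 : Hom P A} {p2 : Hom P B} :
  is_pullback f g p1 p2 -> is_pullback g f p2 p1.
Proof.
move=> [e h]; split=> // Q q1 q2 eq; have [u [[u1 u2] hu]] := h Q q2 q1 (eq_sym eq).
by exists u; split=> // v [v1 v2]; apply: hu.
Qed.

Lemma pb_mono {A B D P : C} {f : Hom A D} {g : Hom B D} {p1 : Hom P A} {p2 : Hom P B} :
  is_pullback f g p1 p2 -> mono g -> mono p1.
Proof.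
move=> pb mg Z a b e; apply: (pb_ext pb e); apply: mg.
by rewrite !comp_assoc -pb.1 -!comp_assoc e.
Qed.

Lemma coprod_ext {A B S : C} {i1 : Hom A S} {i2 : Hom B S} :
  is_coproduct i1 i2 -> forall (Z : C) (a b : Hom S Z),
  a ∘ i1 = b ∘ i1 -> a ∘ i2 = b ∘ i2 -> a = b.
Proof.
move=> h Z a b e1 e2; have [u [_ hu]] := h Z (b ∘ i1) (b ∘ i2).
by rewrite -(hu a) // -(hu b).
Qed.

Lemma coprod3_ext {A B D S : C} {i1 : Hom A S} {i2 : Hom B S} {i3 : Hom D S} :
  is_coproduct3 i1 i2 i3 -> forall (Z : C) (a b : Hom S Z),
  a ∘ i1 = b ∘ i1 -> a ∘ i2 = b ∘ i2 -> a ∘ i3 = b ∘ i3 -> a = b.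
Proof.
move=> h Z a b e1 e2 e3; have [u [_ hu]] := h Z (b ∘ i1) (b ∘ i2) (b ∘ i3).
by rewrite -(hu a) // -(hu b).
Qed.

(** Diagonal fillers on the two summands copair to a filler on the coproduct. *)
Lemma coprod_strong {A B S A' B' S' : C} {i1 : Hom A S} {i2 : Hom B S}
    {i1' : Hom A' S'} {i2' : Hom B' S'} (f : Hom A' A) (g : Hom B' B) (s : Hom S' S) :
  is_coproduct i1 i2 -> is_coproduct i1' i2' ->
  s ∘ i1' = i1 ∘ f -> s ∘ i2' = i2 ∘ g ->
  strong_epi f -> strong_epi g -> strong_epi s.
Proof.
move=> hS hS' e1 e2 hf hg M D m u v mm eq.
have [|a [af ma]] := hf _ _ m (u ∘ i1') (v ∘ i1) mm.
  by rewrite comp_assoc eq -!comp_assoc e1.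
have [|b [bg mb]] := hg _ _ m (u ∘ i2') (v ∘ i2) mm.
  by rewrite comp_assoc eq -!comp_assoc e2.
have [t [[t1 t2] _]] := hS M a b.
exists t; split.
- by apply: (coprod_ext hS'); rewrite -comp_assoc ?e1 ?e2 comp_assoc ?t1 ?t2.
- by apply: (coprod_ext hS); rewrite -comp_assoc ?t1 ?t2.
Qed.

Lemma coprod3_strong {A B D S A' B' D' S' : C}
    {i1 : Hom A S} {i2 : Hom B S} {i3 : Hom D S}
    {i1' : Hom A' S'} {i2' : Hom B' S'} {i3' : Hom D' S'}
    (f : Hom A' A) (g : Hom B' B) (h : Hom D' D) (s : Hom S' S) :
  is_coproduct3 i1 i2 i3 -> is_coproduct3 i1' i2' i3' ->
  s ∘ i1' = i1 ∘ f -> s ∘ i2' = i2 ∘ g -> s ∘ i3' = i3 ∘ h ->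
  strong_epi f -> strong_epi g -> strong_epi h -> strong_epi s.
Proof.
move=> hS hS' e1 e2 e3 hf hg hh M E m u v mm eq.
have [|a [af ma]] := hf _ _ m (u ∘ i1') (v ∘ i1) mm.
  by rewrite comp_assoc eq -!comp_assoc e1.
have [|b [bg mb]] := hg _ _ m (u ∘ i2') (v ∘ i2) mm.
  by rewrite comp_assoc eq -!comp_assoc e2.
have [|c [ch mc]] := hh _ _ m (u ∘ i3') (v ∘ i3) mm.
  by rewrite comp_assoc eq -!comp_assoc e3.
have [t [[t1 [t2 t3]] _]] := hS M a b c.
exists t; split.
- by apply: (coprod3_ext hS'); rewrite -comp_assoc ?e1 ?e2 ?e3 comp_assoc ?t1 ?t2 ?t3.
- by apply: (coprod3_ext hS); rewrite -comp_assoc ?t1 ?t2 ?t3.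
Qed.

(** The two factorizations may use different zero objects, so they are compared along the map [i]
    between these. *)
Lemma zero_mor_unique {A B : C} (f g : Hom A B) :
  is_zero_mor f -> is_zero_mor g -> f = g.
Proof.
move=> [Z [u [v [[iZ _] ->]]]] [Z' [u' [v' [[_ tZ'] ->]]]].
have [i _] := iZ Z'.
have -> : u' = i ∘ u.
  by have [t [_ ht]] := tZ' A; rewrite -(ht u') // -(ht (i ∘ u)).
have -> : v = v' ∘ i.
  by have [t [_ ht]] := iZ B; rewrite -(ht v) // -(ht (v' ∘ i)).
by rewrite comp_assoc.
Qed.

Lemma zero_mor_l {A B D : C} (g : Hom B D) (f : Hom A B) :
  is_zero_mor f -> is_zero_mor (g ∘ f).
Proof.
by move=> [Z [u [v [hZ ->]]]]; exists Z, u, (g ∘ v); rewrite comp_assoc.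
Qed.

Lemma zero_mor_r {A B D : C} (g : Hom B D) (f : Hom A B) :
  is_zero_mor g -> is_zero_mor (g ∘ f).
Proof.
by move=> [Z [u [v [hZ ->]]]]; exists Z, (u ∘ f), v; rewrite comp_assoc.
Qed.

Lemma ker_lift {K A B : C} {f : Hom A B} {k : Hom K A} :
  is_kernel f k -> forall (Z : C) (z : Hom Z A), is_zero_mor (f ∘ z) ->
  exists u : Hom Z K, k ∘ u = z.
Proof. by move=> [_ h] Z z /h [u [hu _]]; exists u. Qed.

Lemma ker_mono {K A B : C} {f : Hom A B} {k : Hom K A} : is_kernel f k -> mono k.
Proof.
move=> [e h] Z a b eq; have [|u [_ hu]] := h Z (k ∘ b).
  by rewrite comp_assoc; apply: zero_mor_r.
by rewrite -(hu a) // -(hu b).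
Qed.

Lemma ker_intro {K A B : C} (f : Hom A B) (k : Hom K A) :
  is_zero_mor (f ∘ k) -> mono k ->
  (forall (Z : C) (z : Hom Z A), is_zero_mor (f ∘ z) -> exists u : Hom Z K, k ∘ u = z) ->
  is_kernel f k.
Proof.
move=> hz mk h; split=> // Z z /h [u hu]; exists u; split=> // v hv.
by apply: mk; rewrite hu hv.
Qed.

Lemma pb_intro {A B D P : C} (f : Hom A D) (g : Hom B D) (p1 : Hom P A) (p2 : Hom P B) :
  f ∘ p1 = g ∘ p2 -> jointly_monic p1 p2 ->
  (forall (Q : C) (q1 : Hom Q A) (q2 : Hom Q B), f ∘ q1 = g ∘ q2 ->
    exists u : Hom Q P, p1 ∘ u = q1 /\ p2 ∘ u = q2) ->
  is_pullback f g p1 p2.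
Proof.
move=> e jm h; split=> // Q q1 q2 /h [u [u1 u2]]; exists u; split=> // v [v1 v2].
by apply: jm; rewrite ?u1 ?u2 ?v1 ?v2.
Qed.

End Generalities.

Ltac crw H := rewrite -?comp_assoc ?H ?(comp_reassoc H) -?comp_assoc.

(** * Zero morphisms and normal epimorphisms in a pointed category *)

Section Pointed.
Context {C : Category} (ptC : @pointed C).

Lemma zero_mor_exists (A B : C) : exists f : Hom A B, is_zero_mor f.
Proof.
case: ptC => Z hZ; have [u _] := hZ.2 A; have [v _] := hZ.1 B.
by exists (v ∘ u), Z, u, v.
Qed.

Lemma mono_zero {A B D : C} (m : Hom B D) (f : Hom A B) :
  mono m -> is_zero_mor (m ∘ f) -> is_zero_mor f.
Proof.
move=> mm hz; have [z zz] := zero_mor_exists A B.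
have -> // : f = z by apply: mm; apply: zero_mor_unique => //; apply: zero_mor_l.
Qed.

Lemma epi_zero {A B D : C} (f : Hom B D) (e : Hom A B) :
  epi e -> is_zero_mor (f ∘ e) -> is_zero_mor f.
Proof.
move=> ee hz; have [z zz] := zero_mor_exists B D.
have -> // : f = z by apply: ee; apply: zero_mor_unique => //; apply: zero_mor_r.
Qed.

(** A cokernel of [k] is a coequalizer of [k] and the zero morphism. *)
Lemma normal_epi_regular {A B : C} (q : Hom A B) : normal_epi q -> regular_epi q.
Proof.
move=> [K [k [qk hq]]]; have [z zz] := zero_mor_exists K A.
exists K, k, z; split; first by apply: zero_mor_unique => //; apply: zero_mor_l.
by move=> Z t tz; apply: hq; rewrite tz; apply: zero_mor_l.
Qed.

End Pointed.

(** * Image factorizations and strong epimorphisms in a regular category *)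

Section Regular.
Context {C : Category} (regC : @regular_category C).

Lemma pullback_exists {A B D : C} (f : Hom A D) (g : Hom B D) :
  exists (P : C) (p1 : Hom P A) (p2 : Hom P B), is_pullback f g p1 p2.
Proof. exact: regC.1.2. Qed.

Lemma product_exists (A B : C) : exists (P : C) (p1 : Hom P A) (p2 : Hom P B),
  jointly_monic p1 p2 /\ forall (Q : C) (q1 : Hom Q A) (q2 : Hom Q B),
    exists u : Hom Q P, p1 ∘ u = q1 /\ p2 ∘ u = q2.
Proof.
case: regC.1.1 => T hT; have [a _] := hT A; have [b _] := hT B.
have [P [p1 [p2 pb]]] := pullback_exists a b.
exists P, p1, p2; split; first exact: pb_ext pb.
move=> Q q1 q2; apply: (pb_lift pb).
by have [t [_ ht]] := hT Q; rewrite -(ht (a ∘ q1)) // -(ht (b ∘ q2)).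
Qed.

Lemma image_exists {A B : C} (f : Hom A B) :
  exists (I : C) (e : Hom A I) (m : Hom I B), regular_epi e /\ mono m /\ m ∘ e = f.
Proof.
have [R [r1 [r2 kp]]] := pullback_exists f f.
have [I [e coeq]] := regC.2.1 _ _ _ _ _ _ kp.
have re : regular_epi e by exists R, r1, r2.
have [m [me _]] := coeq.2 _ f kp.1.
exists I, e, m; split=> //; split=> // Z a b ab.
(* To see that [m] is monic, [a] and then [b] are lifted along [e] after passing to the epimorphic
   covers [p1] and [p1']; the two lifts form a pair in the kernel pair of [f], which [e]
   coequalizes. *)
have [P [p1 [p2 pb]]] := pullback_exists a e.
have hp1 := regular_epi_epi (regC.2.2 _ _ _ _ _ _ _ _ pb re).
have [P' [p1' [p2' pb']]] := pullback_exists (b ∘ p1) e.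
have hp1' := regular_epi_epi (regC.2.2 _ _ _ _ _ _ _ _ pb' re).
apply: (hp1); apply: hp1'.
have [|u [u1 u2]] := pb_lift kp (q1 := p2 ∘ p1') (q2 := p2').
  by rewrite -me -[RHS]comp_assoc -pb'.1; crw (eq_sym pb.1); rewrite !comp_assoc ab.
by rewrite pb'.1 pb.1 -comp_assoc -u1 -u2 !comp_assoc coeq.1.
Qed.

(** The mono part of the image factorization of [e] is invertible, so [e] inherits the coequalizer
    property of the regular part. *)
Lemma strong_regular {A B : C} (e : Hom A B) : strong_epi e -> regular_epi e.
Proof.
move=> he; have [I [g [m [rg [mm mg]]]]] := image_exists e.
have [|i [ie mi]] := he _ _ m g (idm B) mm; first by rewrite comp_id_l.
have im : i ∘ m = idm I.
  by apply: mm; rewrite comp_assoc mi comp_id_l comp_id_r.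
case: rg => R [a [b [gab hg]]]; exists R, a, b; split.
  by rewrite -mg -!comp_assoc gab.
move=> Z z /hg [t [tg ht]]; exists (t ∘ i); split.
  by rewrite -comp_assoc ie.
move=> v ve; rewrite (ht (v ∘ m)); first by rewrite -comp_assoc mg.
by rewrite -comp_assoc mi comp_id_r.
Qed.

Lemma strong_epi_epi {A B : C} (e : Hom A B) : strong_epi e -> epi e.
Proof. by move=> /strong_regular /regular_epi_epi. Qed.

Lemma strong_pullback {A B D P : C} {f : Hom A D} {g : Hom B D}
    {p1 : Hom P A} {p2 : Hom P B} :
  is_pullback f g p1 p2 -> strong_epi g -> strong_epi p1.
Proof.
by move=> pb /strong_regular /(regC.2.2 _ _ _ _ _ _ _ _ pb) /regular_strong.
Qed.

Lemma regular_coequalizes_kernel_pair {A B R : C} {e : Hom A B} {r1 r2 : Hom R A} :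
  is_kernel_pair e r1 r2 -> regular_epi e -> is_coequalizer r1 r2 e.
Proof.
move=> kp [S [a [b [eab he]]]]; split; first exact: kp.1.
move=> Z z zr; apply: he; have [u [<- <-]] := pb_lift kp eab.
by rewrite !comp_assoc zr.
Qed.

Lemma kernel_exists (ptC : @pointed C) {A B : C} (f : Hom A B) :
  exists (K : C) (k : Hom K A), is_kernel f k.
Proof.
case: ptC => Z hZ; have [b [_ hb]] := hZ.1 B.
have [K [k [t pb]]] := pullback_exists f b.
exists K, k; apply: ker_intro.
- by rewrite pb.1; exists Z, t, b.
- move=> X u v uv; apply: (pb_ext pb uv).
  by have [s [_ hs]] := hZ.2 X; rewrite -(hs (t ∘ u)) // -(hs (t ∘ v)).
- move=> X x fx; have [s _] := hZ.2 X.
  have [|u [ku _]] := pb_lift pb (q1 := x) (q2 := s); last by exists u.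
  by apply: zero_mor_unique => //; exists Z, s, b.
Qed.

End Regular.

(** * Protomodularity: points, kernels and the Mal'tsev property *)

Section Homological.
Context {C : Category} (ptC : @pointed C) (regC : @regular_category C)
  (pmC : @protomodular C).

(** Turns kernels into change of base along [0 -> B], the form in which [protomodular] can be
    applied to them. *)
Lemma kernel_pullback {A B K Z : C} {p : Hom A B} {k : Hom K A} (b : Hom Z B) (t : Hom K Z) :
  is_zero_obj Z -> is_kernel p k -> is_pullback p b k t.
Proof.
move=> hZ hk; apply: pb_intro.
- by apply: zero_mor_unique; [exact: hk.1 | exists Z, t, b].
- by move=> X u v uv _; apply: (ker_mono hk).
- move=> X x z eq; have [|u ku] := ker_lift hk (z := x).
    by rewrite eq; exists Z, z, b.
  exists u; split=> //.
  by have [r [_ hr]] := hZ.2 X; rewrite -(hr z) // -(hr (t ∘ u)).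
Qed.

(** Since [k] factors through [m], [p ∘ m] and [p] have the same kernel; change of base along
    [0 -> B] thus takes [m] to an identity, and it reflects isomorphisms. *)
Lemma point_mono_iso {A B K M : C} {p : Hom A B} {s : Hom B A} {k : Hom K A}
    (m : Hom M A) (s0 : Hom B M) (k0 : Hom K M) :
  p ∘ s = idm B -> is_kernel p k -> mono m -> m ∘ s0 = s -> m ∘ k0 = k -> iso m.
Proof.
move=> ps hk mm ms mk; case: (ptC) => Z hZ.
have [b _] := hZ.1 B; have [t _] := hZ.2 K.
have hk0 : is_kernel (p ∘ m) k0.
  apply: ker_intro; first by rewrite -comp_assoc mk; exact: hk.1.
    by apply: (@mono_cancel _ _ _ _ m); rewrite mk; apply: ker_mono hk.
  move=> X x; rewrite -comp_assoc => /(ker_lift hk) [u ku].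
  by exists u; apply: mm; rewrite comp_assoc mk.
apply: (@pmC _ _ b _ _ (p ∘ m) s0 p s m _ _ _ _ _ k0 t _ k t (idm K)) => //.
- by rewrite -comp_assoc ms.
- exact: kernel_pullback.
- exact: kernel_pullback.
- by rewrite comp_id_r.
- by rewrite comp_id_r.
- by exists (idm K); rewrite comp_id_r.
Qed.

(** The equalizer of [u] and [v], built as the pullback of their pairing [w] along the diagonal [d],
    contains both [s] and [k], hence is everything by [point_mono_iso]. *)
Lemma point_jointly_epi {A B K Z : C} {p : Hom A B} {s : Hom B A} {k : Hom K A}
    (u v : Hom A Z) :
  p ∘ s = idm B -> is_kernel p k -> u ∘ s = v ∘ s -> u ∘ k = v ∘ k -> u = v.
Proof.
move=> ps hk us uk.
have [P [p1 [p2 [jm hP]]]] := product_exists regC Z Z.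
have [d [d1 d2]] := hP Z (idm Z) (idm Z).
have [w [w1 w2]] := hP A u v.
have md : mono d.
  by move=> X a b e; rewrite -(comp_id_l a) -(comp_id_l b) -d1 -!comp_assoc e.
have [E [m [n pb]]] := pullback_exists regC w d.
have mm := pb_mono pb md.
have uvm : u ∘ m = v ∘ m.
  by rewrite -w1 -w2 -!comp_assoc pb.1 !comp_assoc d1 d2.
have fact X (x : Hom X A) : u ∘ x = v ∘ x -> exists y, m ∘ y = x.
  move=> e; have [|y [my _]] := pb_lift pb (q1 := x) (q2 := u ∘ x); last by exists y.
  by apply: jm; rewrite !comp_assoc ?w1 ?w2 ?d1 ?d2 comp_id_l.
have [s0 ms] := fact _ _ us; have [k0 mk] := fact _ _ uk.
have [i [_ mi]] := point_mono_iso ps hk mm ms mk.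
by rewrite -(comp_id_r u) -(comp_id_r v) -mi !comp_assoc uvm.
Qed.

(** As [e] coequalizes its kernel pair universally, it suffices that [z ∘ r1 = z ∘ r2]. The kernel
    pair is a point over [A] with section the diagonal [d] and kernel [j = (0,k)]; both sides agree
    on [d], and both vanish on [j]. *)
Lemma kernel_cokernel {K A B : C} {e : Hom A B} {k : Hom K A} :
  strong_epi e -> is_kernel e k -> is_cokernel k e.
Proof.
move=> /(strong_regular regC) re hk; split; first exact: hk.1.
move=> Z z zk; have [R [r1 [r2 kp]]] := pullback_exists regC e e.
apply: (regular_coequalizes_kernel_pair kp re).2.
have [d [d1 d2]] := pb_lift kp (eq_refl (e ∘ idm A)).
have [o oz] := zero_mor_exists ptC K A.
have [|j [j1 j2]] := pb_lift kp (q1 := o) (q2 := k).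
  by apply: zero_mor_unique; [apply: zero_mor_l | exact: hk.1].
have hj : is_kernel r1 j.
  apply: ker_intro; first by rewrite j1.
    by apply: (@mono_cancel _ _ _ _ r2); rewrite j2; apply: ker_mono hk.
  move=> X x rx; have [|y ky] := ker_lift hk (z := r2 ∘ x).
    by rewrite comp_assoc -kp.1 -comp_assoc; apply: zero_mor_l.
  exists y; apply: (pb_ext kp); rewrite comp_assoc ?j1 ?j2 //.
  by apply: zero_mor_unique => //; apply: zero_mor_r.
apply: (point_jointly_epi d1 hj); rewrite -!comp_assoc ?d1 ?d2 // j1 j2.
by apply: zero_mor_unique => //; apply: zero_mor_l.
Qed.

Lemma strong_normal {A B : C} (e : Hom A B) : strong_epi e -> normal_epi e.
Proof.
move=> he; have [K [k hk]] := kernel_exists regC ptC e.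
by exists K, k; apply: kernel_cokernel.
Qed.

(* Short five lemma: pulled back along [p ∘ m], the claim becomes one about points over [I]. *)
Lemma ses_mono_iso {A I Q N : C} (p : Hom Q A) (m : Hom I Q) (n : Hom N Q) (n0 : Hom N I) :
  mono m -> strong_epi (p ∘ m) -> is_kernel p n -> m ∘ n0 = n -> iso m.
Proof.
move=> mm hpm hn mn.
have [P [a [b pb]]] := pullback_exists regC (p ∘ m) p.
have hb := strong_pullback regC (pb_sym pb) hpm.
have [|s [as_ bs]] := pb_lift pb (q1 := idm I) (q2 := m); first by rewrite comp_id_r.
have [o oz] := zero_mor_exists ptC N I.
have [|k [ak bk]] := pb_lift pb (q1 := o) (q2 := n).
  by apply: zero_mor_unique; [apply: zero_mor_l | exact: hn.1].
have hk : is_kernel a k.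
  apply: ker_intro; first by rewrite ak.
    by apply: (@mono_cancel _ _ _ _ b); rewrite bk; apply: ker_mono hn.
  move=> X x ax; have [|y ny] := ker_lift hn (z := b ∘ x).
    by rewrite comp_assoc -pb.1 -comp_assoc; apply: zero_mor_l.
  exists y; apply: (pb_ext pb); rewrite comp_assoc ?ak ?bk //.
  by apply: zero_mor_unique => //; apply: zero_mor_r.
(* The inverse image of [m] along [b] contains the section and the kernel of the point [P], so it is
   all of [P]. Hence the strong epimorphism [b] factors through [m]. *)
have [M [m' [c pb']]] := pullback_exists regC b m.
have [|s0 [ms _]] := pb_lift pb' (q1 := s) (q2 := idm I); first by rewrite bs comp_id_r.
have [|k0 [mk _]] := pb_lift pb' (q1 := k) (q2 := n0); first by rewrite bk mn.
have [i [_ mi]] := point_mono_iso as_ hk (pb_mono pb' mm) ms mk.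
apply: strong_mono_iso => //; apply: (@strong_cancel _ _ _ _ _ (c ∘ i)).
by rewrite comp_assoc -pb'.1 -comp_assoc mi comp_id_r.
Qed.

(* The comparison [A' -> A ×_B B'] is strong: its image contains the kernel of the
   projection to [A], because that kernel is reached through the section [s']. *)
Lemma point_kernel_strong {A B K A' B' K' : C}
    {p : Hom A B} {s : Hom B A} {k : Hom K A}
    {p' : Hom A' B'} {s' : Hom B' A'} {k' : Hom K' A'}
    (a : Hom A' A) (b : Hom B' B) (phi : Hom K' K) :
  p' ∘ s' = idm B' -> is_kernel p k -> is_kernel p' k' ->
  p ∘ a = b ∘ p' -> a ∘ s' = s ∘ b -> k ∘ phi = a ∘ k' ->
  strong_epi a -> strong_epi b -> strong_epi phi.
Proof.
move=> ps' hk hk' pa as_ kphi ha hb.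
have [Q [q1 [q2 pb]]] := pullback_exists regC p b.
have [c [c1 c2]] := pb_lift pb pa.
have hc : strong_epi c.
  have [I [e [m [re [mm me]]]]] := image_exists regC c.
  have [N [n hn]] := kernel_exists regC ptC q1.
  rewrite -me; apply: strong_comp; last exact: regular_strong.
  (* An element of the kernel of [q1] is a pair [(0,b')] with [b b' = 0], and [c] sends [s' b'] to
     [(s b b', p' s' b') = (0,b')]; this gives the witness [n0]. *)
  apply: iso_strong; apply: (ses_mono_iso (p := q1) (n := n) (n0 := e ∘ (s' ∘ (q2 ∘ n)))) => //.
    by apply: (@strong_cancel _ _ _ _ _ e); rewrite -comp_assoc me c1.
  rewrite comp_assoc me; apply: (pb_ext pb).
    rewrite comp_assoc c1; crw as_; crw (eq_sym pb.1).
    by apply: zero_mor_unique; [do 2!apply: zero_mor_l; exact: hn.1 | exact: hn.1].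
  by rewrite comp_assoc c2; crw ps'; rewrite comp_id_l.
have [o oz] := zero_mor_exists ptC K B'.
have [|j [j1 j2]] := pb_lift pb (q1 := k) (q2 := o).
  by apply: zero_mor_unique; [exact: hk.1 | apply: zero_mor_l].
(* [phi] is the pullback of [c] along the inclusion [j = (k,0)] of [K] into [A ×_B B']. *)
apply: (strong_pullback regC (f := j) (g := c) (p2 := k')) => //; apply: pb_intro.
- apply: (pb_ext pb); rewrite !comp_assoc ?c1 ?c2 ?j1 ?j2 //.
  by apply: zero_mor_unique; [apply: zero_mor_r | exact: hk'.1].
- by move=> X u v _; apply: (ker_mono hk').
- move=> X u v eq; have [|w kw] := ker_lift hk' (z := v).
    by rewrite -c2 -comp_assoc -eq comp_assoc j2; apply: zero_mor_r.
  exists w; split=> //; apply: (ker_mono hk).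
  by rewrite comp_assoc kphi -comp_assoc kw -j1 -c1 -!comp_assoc eq.
Qed.

(** Over [D], the pullback is a point with section [r], and its kernel is that of [p], embedded by
    [l ∘ k]. A subobject containing [l] and [r] therefore contains both section and kernel. *)
Lemma pullback_points_iso {A B D P M : C} {p : Hom A B}
    {p2 : Hom D B} {s2 : Hom B D} {u : Hom P A} {v : Hom P D}
    (l : Hom A P) (r : Hom D P) (m : Hom M P) (l0 : Hom A M) (r0 : Hom D M) :
  is_pullback p p2 u v -> u ∘ l = idm A -> v ∘ l = s2 ∘ p -> v ∘ r = idm D ->
  mono m -> m ∘ l0 = l -> m ∘ r0 = r -> iso m.
Proof.
move=> pb ul vl vr mm ml mr; have [K [k hk]] := kernel_exists regC ptC p.
apply: (point_mono_iso (p := v) (s := r) (k := l ∘ k) (s0 := r0) (k0 := l0 ∘ k)) => //;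
  last by rewrite comp_assoc ml.
apply: ker_intro.
- by rewrite comp_assoc vl -comp_assoc; apply: zero_mor_l; exact: hk.1.
- apply: (@mono_cancel _ _ _ _ u); rewrite comp_assoc ul comp_id_l.
  exact: ker_mono hk.
- move=> X x vx; have [|y ky] := ker_lift hk (z := u ∘ x).
    by rewrite comp_assoc pb.1 -comp_assoc; apply: zero_mor_l.
  exists y; rewrite -comp_assoc ky; apply: (pb_ext pb).
    by rewrite comp_assoc ul comp_id_l.
  apply: zero_mor_unique => //; rewrite comp_assoc vl -comp_assoc -ky.
  by rewrite [p ∘ _]comp_assoc; apply: zero_mor_l; apply: zero_mor_r; exact: hk.1.
Qed.

(* With [u = (a,b)], [v = (c,b)], [t = (c,d)], the quadruples such that [(a,d)] is again
   in the relation form a subobject of a pullback of points over [R]; it contains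
   both canonical sections, namely the cases [d = b] and [a = c]. *)
Lemma relation_difunctional {R A B Z : C} {r1 : Hom R A} {r2 : Hom R B} (u v t : Hom Z R) :
  jointly_monic r1 r2 -> r2 ∘ u = r2 ∘ v -> r1 ∘ v = r1 ∘ t ->
  exists w : Hom Z R, r1 ∘ w = r1 ∘ u /\ r2 ∘ w = r2 ∘ t.
Proof.
move=> jm uv vt.
have [E1 [a1 [c1 pb1]]] := pullback_exists regC r2 r2.
have [E2 [c2 [b2 pb2]]] := pullback_exists regC r1 r1.
have [d1 [ad1 cd1]] := pb_lift pb1 (eq_refl (r2 ∘ idm R)).
have [d2 [cd2 bd2]] := pb_lift pb2 (eq_refl (r1 ∘ idm R)).
have [P [x1 [x2 pb]]] := pullback_exists regC c1 c2.
have [|l [l1 l2]] := pb_lift pb (q1 := idm E1) (q2 := d2 ∘ c1).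
  by rewrite comp_assoc cd2 comp_id_l comp_id_r.
have [|r [r1_ r2_]] := pb_lift pb (q1 := d1 ∘ c2) (q2 := idm E2).
  by rewrite comp_assoc cd1 comp_id_l comp_id_r.
have [AB [y1 [y2 [jy hy]]]] := product_exists regC A B.
have [i [i1 i2]] := hy R r1 r2.
have mi : mono i.
  by move=> X f g e; apply: jm; rewrite -?i1 -?i2 -!comp_assoc e.
(* [P] consists of the triples [(u,v,t)], and [j] sends such a triple to [(a,d)]. The subobject [M]
   collects those with [(a,d)] in [R]; [l] and [r] are [(u,v,v)] and [(v,v,t)]. *)
have [j [j1 j2]] := hy P (r1 ∘ (a1 ∘ x1)) (r2 ∘ (b2 ∘ x2)).
have [M [m [n pbm]]] := pullback_exists regC j i.
have [|l0 [ml _]] := pb_lift pbm (q1 := l) (q2 := a1).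
  apply: jy; rewrite !comp_assoc ?i1 ?i2 ?j1 ?j2 -!comp_assoc ?l1 ?l2 ?comp_id_r //.
  by crw bd2; rewrite comp_id_l pb1.1.
have [|r0 [mr _]] := pb_lift pbm (q1 := r) (q2 := b2).
  apply: jy; rewrite !comp_assoc ?i1 ?i2 ?j1 ?j2 -!comp_assoc ?r1_ ?r2_ ?comp_id_r //.
  by crw ad1; rewrite comp_id_l pb2.1.
have [m' [_ mm']] :=
  pullback_points_iso pb l1 l2 r2_ (pb_mono pbm mi) ml mr.
have [z1 [az1 cz1]] := pb_lift pb1 uv; have [z2 [cz2 bz2]] := pb_lift pb2 vt.
have [|z [xz1 xz2]] := pb_lift pb (q1 := z1) (q2 := z2); first by rewrite cz1 cz2.
have e : i ∘ (n ∘ (m' ∘ z)) = j ∘ z.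
  by rewrite !comp_assoc -pbm.1 -(comp_assoc j) mm' comp_id_r.
exists (n ∘ (m' ∘ z)); split.
- by rewrite -{1}i1 -comp_assoc e comp_assoc j1 -!comp_assoc xz1 az1.
- by rewrite -{1}i2 -comp_assoc e comp_assoc j2 -!comp_assoc xz2 bz2.
Qed.

(** The Mal'tsev property. Difunctionality yields symmetry from [(b,b)], [(a,b)], [(a,a)] and
    transitivity from [(a,b)], [(b,b)], [(b,c)]. *)
Lemma reflexive_equivalence {R A : C} (r1 r2 : Hom R A) (d : Hom A R) :
  jointly_monic r1 r2 -> r1 ∘ d = idm A -> r2 ∘ d = idm A -> equivalence_relation r1 r2.
Proof.
move=> jm d1 d2; split=> //; split; first by exists d.
split.
- have [||s [s1 s2]] := relation_difunctional (u := d ∘ r2) (v := idm R) (t := d ∘ r1) jm.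
    by rewrite comp_assoc d2 comp_id_l comp_id_r.
    by rewrite comp_assoc d1 comp_id_l comp_id_r.
  by exists s; rewrite s1 s2 !comp_assoc d1 d2 !comp_id_l.
- move=> P p1 p2 pb.
  have [||t [t1 t2]] := relation_difunctional (u := p1) (v := d ∘ (r2 ∘ p1)) (t := p2) jm.
    by rewrite (comp_assoc r2 d) d2 comp_id_l.
    by rewrite (comp_assoc r1 d) d1 comp_id_l pb.1.
  by exists t.
Qed.

End Homological.

(** * Direct images of kernels in the exact case *)

Section Exact.
Context {C : Category} (ptC : @pointed C) (exC : @barr_exact C) (pmC : @protomodular C).
Let regC := exC.1.

(* The image along [alpha] of the kernel pair of [nu] is reflexive, hence by exactness the
   kernel pair of some [t], and [point_kernel_strong] compares the two kernels. *)
Lemma kernel_direct_image {A A' T' N' : C} (alpha : Hom A' A) (nu : Hom A' T') (n' : Hom N' A') :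
  strong_epi alpha -> is_kernel nu n' ->
  exists (T N : C) (t : Hom A T) (n : Hom N A) (e : Hom N' N),
    is_kernel t n /\ strong_epi e /\ n ∘ e = alpha ∘ n'.
Proof.
move=> ha hn'.
have [R [r1 [r2 kp]]] := pullback_exists regC nu nu.
have [d [d1 d2]] := pb_lift kp (eq_refl (nu ∘ idm A')).
have [AA [y1 [y2 [jy hy]]]] := product_exists regC A A.
have [w [w1 w2]] := hy R (alpha ∘ r1) (alpha ∘ r2).
have [I [e [m [re [mm me]]]]] := image_exists regC w.
have he := regular_strong re.
pose s1 := y1 ∘ m; pose s2 := y2 ∘ m.
have s1e : s1 ∘ e = alpha ∘ r1 by rewrite /s1 -comp_assoc me.
have s2e : s2 ∘ e = alpha ∘ r2 by rewrite /s2 -comp_assoc me.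
have jm : jointly_monic s1 s2.
  by move=> X a b; rewrite /s1 /s2 -!comp_assoc => e1 e2; apply: mm; apply: jy.
have [diag [g1 g2]] := hy A (idm A) (idm A).
(* Reflexivity of the image: [e ∘ d] lifts the diagonal of [A] restricted along [alpha], and
   strength of [alpha] extends this lift to all of [A]. *)
have [|c [ca mc]] := ha _ _ m (e ∘ d) diag mm.
  rewrite comp_assoc me.
  apply: jy; rewrite !comp_assoc ?w1 ?w2 ?g1 ?g2 -comp_assoc ?d1 ?d2.
    by rewrite comp_id_l comp_id_r.
  by rewrite comp_id_l comp_id_r.
have c1 : s1 ∘ c = idm A by rewrite /s1 -comp_assoc mc.
have c2 : s2 ∘ c = idm A by rewrite /s2 -comp_assoc mc.
clearbody s1 s2.
have [T [t kpt]] := exC.2 _ _ _ _ (reflexive_equivalence ptC regC pmC jm c1 c2).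
have [N [k hk]] := kernel_exists regC ptC s1.
have [o oz] := zero_mor_exists ptC N' A'.
have [|k' [rk1 rk2]] := pb_lift kp (q1 := o) (q2 := n').
  by apply: zero_mor_unique; [apply: zero_mor_l | exact: hn'.1].
have hk' : is_kernel r1 k'.
  apply: ker_intro; first by rewrite rk1.
    by apply: (@mono_cancel _ _ _ _ r2); rewrite rk2; apply: ker_mono hn'.
  move=> X x rx; have [|y ny] := ker_lift hn' (z := r2 ∘ x).
    by rewrite comp_assoc -kp.1 -comp_assoc; apply: zero_mor_l.
  exists y; apply: (pb_ext kp); rewrite comp_assoc ?rk1 ?rk2 //.
  by apply: zero_mor_unique => //; apply: zero_mor_r.
have [|phi kphi] := ker_lift hk (z := e ∘ k').
  by rewrite comp_assoc s1e -comp_assoc rk1; apply: zero_mor_l.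
(* The kernel of [t] consists of the elements related to [0]: it is [s2] restricted to the kernel of
   [s1], just as [n'] is [r2 ∘ k']. *)
exists T, N, t, (s2 ∘ k), phi; split; last first.
  split; last by rewrite -comp_assoc kphi comp_assoc s2e -comp_assoc rk2.
  exact: (point_kernel_strong ptC regC pmC (s := c) d1 hk hk' s1e (eq_sym ca)).
apply: ker_intro.
- by rewrite comp_assoc -kpt.1 -comp_assoc; apply: zero_mor_l; exact: hk.1.
- move=> X a b; rewrite -!comp_assoc => eq; apply: (ker_mono hk); apply: jm => //.
  by apply: zero_mor_unique; rewrite comp_assoc; apply: zero_mor_r; exact: hk.1.
- move=> X x tx; have [o' oz'] := zero_mor_exists ptC X A.
  have [|u [u1 u2]] := pb_lift kpt (q1 := o') (q2 := x).
    by apply: zero_mor_unique => //; apply: zero_mor_l.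
  have [|v kv] := ker_lift hk (z := u); first by rewrite u1.
  by exists v; rewrite -comp_assoc kv.
Qed.

End Exact.

(** * Weighted commutators: the comparison [q] and its kernel *)

Section WeightedCommutator.
Context {C : Category} (HC : semi_abelian C).
Let ptC := HC.1.
Let exC := HC.2.1.
Let regC := exC.1.
Let pmC := HC.2.2.1.

Section Data.
Context {W X Y A : C} {w : Hom W A} {x : Hom X A} {y : Hom Y A} (D : wcomm_data w x y).

(** The coproduct inclusions of [W+X] and [W+Y] into [W+X+Y] split [pp1 ∘ q] and [pp2 ∘ q], and [q]
    carries them to the two canonical sections of the pullback of points over [W]. *)
Lemma wcomm_sections : exists (sX : Hom (cWX D) (cS D)) (sY : Hom (cWY D) (cS D)),
  (sX ∘ j1 D = ci1 D /\ sX ∘ j2 D = ci2 D) /\ (sY ∘ l1 D = ci1 D /\ sY ∘ l2 D = ci3 D) /\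
  (pp1 D ∘ q D ∘ sX = idm _ /\ pp2 D ∘ q D ∘ sX = l1 D ∘ rX D) /\
  (pp2 D ∘ q D ∘ sY = idm _ /\ pp1 D ∘ q D ∘ sY = j1 D ∘ rY D).
Proof.
have [sX [[sX1 sX2] _]] := j_coprod D (ci1 D) (ci2 D).
have [sY [[sY1 sY2] _]] := l_coprod D (ci1 D) (ci3 D).
exists sX, sY; split=> //; split=> //; split; split.
- apply: (coprod_ext (j_coprod D)); rewrite comp_id_l -comp_assoc ?sX1 ?sX2.
    exact: q1_1.
  exact: q1_2.
- apply: (coprod_ext (j_coprod D)); rewrite -!comp_assoc ?sX1 ?sX2 comp_assoc.
    by rewrite q2_1 rX_1 comp_id_r.
  by apply: zero_mor_unique; [exact: q2_2 | apply: zero_mor_l; exact: rX_2].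
- apply: (coprod_ext (l_coprod D)); rewrite comp_id_l -comp_assoc ?sY1 ?sY2.
    exact: q2_1.
  exact: q2_3.
- apply: (coprod_ext (l_coprod D)); rewrite -!comp_assoc ?sY1 ?sY2 comp_assoc.
    by rewrite q1_1 rY_1 comp_id_r.
  by apply: zero_mor_unique; [exact: q1_3 | apply: zero_mor_l; exact: rY_2].
Qed.

(** The image of [q] contains both canonical sections of the pullback, hence is all of it by
    [pullback_points_iso]. *)
Lemma wcomm_q_strong : strong_epi (q D).
Proof.
have [sX [sY [_ [_ [[pX pY] [qY _]]]]]] := wcomm_sections.
have [I [e [m [re [mm me]]]]] := image_exists regC (q D).
rewrite -me; apply: strong_comp; last exact: regular_strong.
apply: iso_strong.
apply: (pullback_points_iso ptC regC pmC (l := q D ∘ sX) (r := q D ∘ sY) (s2 := l1 D)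
          (l0 := e ∘ sX) (r0 := e ∘ sY) (P_pb D)) => //; by rewrite comp_assoc ?me.
Qed.

(* The kernel of [q] is computed in two steps, each of them the kernel of a split
   epimorphism: [L1] is the kernel of [W+X+Y -> W+X], [L0] that of [W+Y -> W], and [cK] is
   the kernel of [L1 -> L0]. *)
Lemma wcomm_kernel_steps (sY : Hom (cWY D) (cS D)) :
  pp2 D ∘ q D ∘ sY = idm _ -> pp1 D ∘ q D ∘ sY = j1 D ∘ rY D ->
  exists (L1 L0 : C) (i1 : Hom L1 (cS D)) (i0 : Hom L0 (cWY D))
    (r : Hom L1 L0) (s : Hom L0 L1) (k : Hom (cK D) L1),
    is_kernel (pp1 D ∘ q D) i1 /\ is_kernel (rY D) i0 /\ is_kernel r k /\
    r ∘ s = idm L0 /\ i0 ∘ r = pp2 D ∘ q D ∘ i1 /\ i1 ∘ s = sY ∘ i0 /\ i1 ∘ k = kq D.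
Proof.
move=> pYs pXs.
have [L1 [i1 h1]] := kernel_exists regC ptC (pp1 D ∘ q D).
have [L0 [i0 h0]] := kernel_exists regC ptC (rY D).
have [|r ir] := ker_lift h0 (z := pp2 D ∘ q D ∘ i1).
  rewrite !comp_assoc -(P_pb D).1 -!comp_assoc; apply: zero_mor_l.
  by rewrite comp_assoc; exact: h1.1.
have [|s is_] := ker_lift h1 (z := sY ∘ i0).
  by rewrite comp_assoc pXs -comp_assoc; apply: zero_mor_l; exact: h0.1.
have [|k ik] := ker_lift h1 (z := kq D).
  by rewrite -comp_assoc; apply: zero_mor_l; exact: (kq_ker D).1.
exists L1, L0, i1, i0, r, s, k.
have rs : r ∘ s = idm L0.
  apply: (ker_mono h0).
  by rewrite comp_assoc ir -comp_assoc is_ comp_assoc pYs comp_id_l comp_id_r.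
do 2![split=> //]; split=> //; apply: ker_intro.
- apply: (mono_zero ptC (ker_mono h0)).
  rewrite comp_assoc ir -comp_assoc ik -comp_assoc; apply: zero_mor_l.
  exact: (kq_ker D).1.
- by apply: (@mono_cancel _ _ _ _ i1); rewrite ik; apply: ker_mono (kq_ker D).
- move=> Z z rz; have [|u ku] := ker_lift (kq_ker D) (z := i1 ∘ z); last first.
    by exists u; apply: (ker_mono h1); rewrite comp_assoc ik.
  have [o oz] := zero_mor_exists ptC Z (cP D).
  (* The first component vanishes because [i1] is the kernel of [pp1 ∘ q], the second because it
     equals [i0 ∘ r ∘ z]. *)
  have -> // : q D ∘ (i1 ∘ z) = o.
  apply: (pb_ext (P_pb D)); apply: zero_mor_unique; try exact: zero_mor_l.
    by rewrite !comp_assoc; apply: zero_mor_r; exact: h1.1.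
  by rewrite !comp_assoc -ir -comp_assoc; apply: zero_mor_l.
Qed.

End Data.

(** * Morphisms induced between weighted commutators *)

Section Naturality.
Context {X X' Y Y' W W' A A' : C}
  {f : Hom X' X} {g : Hom Y' Y} {h : Hom W' W} {alpha : Hom A' A}
  {x : Hom X A} {y : Hom Y A} {w : Hom W A}
  {x' : Hom X' A'} {y' : Hom Y' A'} {w' : Hom W' A'}
  (D : wcomm_data w x y) (D' : wcomm_data w' x' y').

Lemma wcomm_map :
  exists (s : Hom (cS D') (cS D)) (a : Hom (cWX D') (cWX D)) (b : Hom (cWY D') (cWY D)),
  (s ∘ ci1 D' = ci1 D ∘ h /\ s ∘ ci2 D' = ci2 D ∘ f /\ s ∘ ci3 D' = ci3 D ∘ g) /\
  (a ∘ j1 D' = j1 D ∘ h /\ a ∘ j2 D' = j2 D ∘ f) /\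
  (b ∘ l1 D' = l1 D ∘ h /\ b ∘ l2 D' = l2 D ∘ g) /\
  pp1 D ∘ q D ∘ s = a ∘ (pp1 D' ∘ q D') /\ pp2 D ∘ q D ∘ s = b ∘ (pp2 D' ∘ q D') /\
  rX D ∘ a = h ∘ rX D' /\ rY D ∘ b = h ∘ rY D'.
Proof.
have [s [[s1 [s2 s3]] _]] := c_coprod D' (ci1 D ∘ h) (ci2 D ∘ f) (ci3 D ∘ g).
have [a [[a1 a2] _]] := j_coprod D' (j1 D ∘ h) (j2 D ∘ f).
have [b [[b1 b2] _]] := l_coprod D' (l1 D ∘ h) (l2 D ∘ g).
exists s, a, b; do 3![split=> //]; split; [|split; [|split]].
- apply: (coprod3_ext (c_coprod D')); rewrite -[LHS]comp_assoc -[RHS]comp_assoc ?s1 ?s2 ?s3.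
  + by rewrite q1_1 a1 comp_assoc q1_1.
  + by rewrite q1_2 a2 comp_assoc q1_2.
  + apply: zero_mor_unique; last by apply: zero_mor_l; exact: q1_3.
    by rewrite comp_assoc; apply: zero_mor_r; exact: q1_3.
- apply: (coprod3_ext (c_coprod D')); rewrite -[LHS]comp_assoc -[RHS]comp_assoc ?s1 ?s2 ?s3.
  + by rewrite q2_1 b1 comp_assoc q2_1.
  + apply: zero_mor_unique; last by apply: zero_mor_l; exact: q2_2.
    by rewrite comp_assoc; apply: zero_mor_r; exact: q2_2.
  + by rewrite q2_3 b2 comp_assoc q2_3.
- apply: (coprod_ext (j_coprod D')); rewrite -!comp_assoc ?a1 ?a2.
    by rewrite comp_assoc !rX_1 comp_id_l comp_id_r.
  apply: zero_mor_unique; last by apply: zero_mor_l; exact: rX_2.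
  by rewrite comp_assoc; apply: zero_mor_r; exact: rX_2.
- apply: (coprod_ext (l_coprod D')); rewrite -!comp_assoc ?b1 ?b2.
    by rewrite comp_assoc !rY_1 comp_id_l comp_id_r.
  apply: zero_mor_unique; last by apply: zero_mor_l; exact: rY_2.
  by rewrite comp_assoc; apply: zero_mor_r; exact: rY_2.
Qed.

Context (hf : strong_epi f) (hg : strong_epi g) (hh : strong_epi h).

(** Three uses of [point_kernel_strong]: over [W+X+Y -> W+X] for [u1], over [W+Y -> W] for [u0], and
    over [L1 -> L0] for [k]. *)
Lemma wcomm_kernel_map_strong :
  exists (s : Hom (cS D') (cS D)) (p : Hom (cP D') (cP D)) (k : Hom (cK D') (cK D)),
  (s ∘ ci1 D' = ci1 D ∘ h /\ s ∘ ci2 D' = ci2 D ∘ f /\ s ∘ ci3 D' = ci3 D ∘ g) /\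
  q D ∘ s = p ∘ q D' /\ kq D ∘ k = s ∘ kq D' /\ strong_epi k.
Proof.
have [s [a [b [[s1 [s2 s3]] [[a1 a2] [[b1 b2] [pXs [pYs [rXa rYb]]]]]]]]] := wcomm_map.
have [|p [p1 p2]] := pb_lift (P_pb D) (q1 := a ∘ pp1 D') (q2 := b ∘ pp2 D').
  by rewrite !comp_assoc rXa rYb -!comp_assoc (P_pb D').1.
have qs : q D ∘ s = p ∘ q D'.
  apply: (pb_ext (P_pb D)); rewrite !comp_assoc ?pXs ?pYs ?p1 ?p2.
    by rewrite comp_assoc.
  by rewrite comp_assoc.
have [|k kk] := ker_lift (kq_ker D) (z := s ∘ kq D').
  rewrite comp_assoc qs -comp_assoc; apply: zero_mor_l; exact: (kq_ker D').1.
exists s, p, k; do 3![split=> //].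
have ss := coprod3_strong (c_coprod D) (c_coprod D') s1 s2 s3 hh hf hg.
have sa := coprod_strong (j_coprod D) (j_coprod D') a1 a2 hh hf.
have sb := coprod_strong (l_coprod D) (l_coprod D') b1 b2 hh hg.
have [tX [tY [[tX1 tX2] [[tY1 tY2] [_ [pYt pXt]]]]]] := wcomm_sections D.
have [tX' [tY' [[tX1' tX2'] [[tY1' tY2'] [[pXtX' _] [pYt' pXt']]]]]] := wcomm_sections D'.
have stX : s ∘ tX' = tX ∘ a.
  apply: (coprod_ext (j_coprod D')); rewrite -!comp_assoc ?tX1' ?tX2' ?a1 ?a2.
    by rewrite s1 comp_assoc tX1.
  by rewrite s2 comp_assoc tX2.
have stY : s ∘ tY' = tY ∘ b.
  apply: (coprod_ext (l_coprod D')); rewrite -!comp_assoc ?tY1' ?tY2' ?b1 ?b2.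
    by rewrite s1 comp_assoc tY1.
  by rewrite s3 comp_assoc tY2.
have [L1 [L0 [i1 [i0 [r [t [c [hi1 [hi0 [hc [rt [ir [it ic]]]]]]]]]]]]] :=
  wcomm_kernel_steps pYt pXt.
have [L1' [L0' [i1' [i0' [r' [t' [c' [hi1' [hi0' [hc' [rt' [ir' [it' ic']]]]]]]]]]]]] :=
  wcomm_kernel_steps pYt' pXt'.
have [|u1 iu1] := ker_lift hi1 (z := s ∘ i1').
  by rewrite comp_assoc pXs -comp_assoc; apply: zero_mor_l; exact: hi1'.1.
have [|u0 iu0] := ker_lift hi0 (z := b ∘ i0').
  by rewrite comp_assoc rYb -comp_assoc; apply: zero_mor_l; exact: hi0'.1.
have su1 := point_kernel_strong ptC regC pmC pXtX' hi1 hi1' pXs stX iu1 ss sa.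
have su0 := point_kernel_strong ptC regC pmC (rY_1 D') hi0 hi0' rYb b1 iu0 sb hh.
apply: (point_kernel_strong ptC regC pmC (a := u1) (b := u0) (s := t) rt' hc hc') => //.
- apply: (ker_mono hi0); rewrite !comp_assoc ir iu0 -!comp_assoc iu1 ir' !comp_assoc.
  by rewrite pYs !comp_assoc.
- apply: (ker_mono hi1); rewrite !comp_assoc iu1 it -!comp_assoc it' iu0 !comp_assoc.
  by rewrite stY.
- apply: (ker_mono hi1); rewrite !comp_assoc ic iu1 -!comp_assoc ic'.
  exact: kk.
Qed.

Context (ha : strong_epi alpha)
  (ex : x ∘ f = alpha ∘ x') (ey : y ∘ g = alpha ∘ y') (ew : w ∘ h = alpha ∘ w').

Lemma wcomm_induced : induced_normal_epis alpha D D'.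
Proof.
have [s [p [k [[s1 [s2 s3]] [qs [kk sk]]]]]] := wcomm_kernel_map_strong.
have cs : cmap D ∘ s = alpha ∘ cmap D'.
  by apply: (coprod3_ext (c_coprod D')); rewrite -!comp_assoc ?s1 ?s2 ?s3 comp_assoc
     ?cmap_1 ?cmap_2 ?cmap_3.
have cks : cmap D ∘ kq D ∘ k = alpha ∘ (cmap D' ∘ kq D').
  by rewrite -comp_assoc kk !comp_assoc cs.
split.
(* [phi] is the diagonal filler between the two image factorizations; it is strong because
   [phi ∘ ce D' = ce D ∘ k] is. *)
- have [|phi [phie kphi]] := regular_strong (ce_reg D') (u := ce D ∘ k)
    (v := alpha ∘ ckappa D') (@ckappa_mono _ _ _ _ _ _ _ _ D).
    by rewrite comp_assoc cfact -[RHS]comp_assoc cfact.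
  exists phi; split=> //; apply: (strong_normal ptC regC pmC).
  apply: (@strong_cancel _ _ _ _ _ (ce D')); rewrite phie.
  by apply: strong_comp => //; apply: regular_strong; exact: ce_reg.
- have [|v [[vn _] _]] := (po D').2 _ (nu D ∘ alpha) (mu D ∘ p).
    by rewrite -comp_assoc -cs comp_assoc (po D).1 -!comp_assoc qs.
  have [|psi kpsi] := ker_lift (nker D) (z := alpha ∘ nkappa D').
    by rewrite comp_assoc -vn -comp_assoc; apply: zero_mor_l; exact: (nker D').1.
  exists psi; split=> //; apply: (strong_normal ptC regC pmC).
  have [T [N [t [n [e [hn [se ne]]]]]]] := kernel_direct_image ptC exC pmC ha (nker D').
  (* It suffices to check this after the epimorphism [k], where the composite factors through
     [alpha ∘ nkappa D' = n ∘ e], which [t] kills. *)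
  have tc : is_zero_mor (t ∘ (cmap D ∘ kq D)).
    apply: (epi_zero ptC (strong_epi_epi regC sk)); rewrite -comp_assoc cks.
    have [|i <-] := ker_lift (nker D') (z := cmap D' ∘ kq D').
      rewrite comp_assoc (po D').1 -comp_assoc; apply: zero_mor_l.
      exact: (kq_ker D').1.
    rewrite !comp_assoc -(comp_assoc t) -ne comp_assoc.
    by do 2!apply: zero_mor_r; exact: hn.1.
  (* As [q] is the cokernel of its kernel, [t ∘ cmap D] factors through [q]; the pushout then makes
     [t] factor through [nu], so the kernel of [nu] lies in [N]. *)
  have [|z [zq _]] := (kernel_cokernel ptC regC pmC (@wcomm_q_strong _ _ _ _ _ _ _ D)
    (kq_ker D)).2 _ (t ∘ cmap D).
    by rewrite -comp_assoc.
  have [|u [[un _] _]] := (po D).2 _ t z; first by rewrite zq.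
  have [|j nj] := ker_lift hn (z := nkappa D).
    by rewrite -un -comp_assoc; apply: zero_mor_l; exact: (nker D).1.
  have je : j ∘ psi = e by apply: (ker_mono hn); rewrite comp_assoc nj kpsi ne.
  (* Conversely the strong epimorphism [e] factors through the inclusion [j], which is thus
     invertible, and [psi] is [e] up to isomorphism. *)
  have [||i [ij ji]] := strong_mono_iso (e := j).
    by apply: (@strong_cancel _ _ _ _ _ psi); rewrite je.
    by apply: (@mono_cancel _ _ _ _ n); rewrite nj; apply: ker_mono (nker D).
  have -> : psi = i ∘ e by rewrite -je comp_assoc ij comp_id_l.
  by apply: strong_comp => //; apply: iso_strong; exists j.
Qed.

End Naturality.
End WeightedCommutator.

Theorem theorem5p2 (C : Category) (HC : semi_abelian C) :
  (* general weighted case *)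
  (forall (X X' Y Y' W W' A A' : C)
     (f : Hom X' X) (g : Hom Y' Y) (h : Hom W' W) (alpha : Hom A' A)
     (x : Hom X A) (y : Hom Y A) (w : Hom W A)
     (x' : Hom X' A') (y' : Hom Y' A') (w' : Hom W' A'),
     normal_epi f -> normal_epi g -> normal_epi h -> normal_epi alpha ->
     x ∘ f = alpha ∘ x' -> y ∘ g = alpha ∘ y' -> w ∘ h = alpha ∘ w' ->
     forall (D : wcomm_data w x y) (D' : wcomm_data w' x' y'),
       induced_normal_epis alpha D D') /\
  (* 0-weighted case: (W,w) = (0,0), (W',w') = (0,0), h = 1_0 *)
  (forall (Z : C), is_zero_obj Z ->
   forall (X X' Y Y' A A' : C)
     (f : Hom X' X) (g : Hom Y' Y) (alpha : Hom A' A)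
     (x : Hom X A) (y : Hom Y A) (x' : Hom X' A') (y' : Hom Y' A')
     (z : Hom Z A) (z' : Hom Z A'),
     is_zero_mor z -> is_zero_mor z' ->
     normal_epi f -> normal_epi g -> normal_epi alpha ->
     x ∘ f = alpha ∘ x' -> y ∘ g = alpha ∘ y' ->
     forall (D : wcomm_data z x y) (D' : wcomm_data z' x' y'),
       induced_normal_epis alpha D D') /\
  (* 1-weighted case: (W,w) = (A,1_A), (W',w') = (A',1_A'), h = alpha *)
  (forall (X X' Y Y' A A' : C)
     (f : Hom X' X) (g : Hom Y' Y) (alpha : Hom A' A)
     (x : Hom X A) (y : Hom Y A) (x' : Hom X' A') (y' : Hom Y' A'),
     normal_epi f -> normal_epi g -> normal_epi alpha ->
     x ∘ f = alpha ∘ x' -> y ∘ g = alpha ∘ y' ->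
     forall (D : wcomm_data (idm A) x y) (D' : wcomm_data (idm A') x' y'),
       induced_normal_epis alpha D D').
Proof.
have nes (A B : C) (e : Hom A B) : normal_epi e -> strong_epi e.
  by move=> /(normal_epi_regular HC.1); exact: regular_strong.
split; [|split].
- move=> X X' Y Y' W W' A A' f g h alpha x y w x' y' w'.
  move=> /nes hf /nes hg /nes hh /nes ha ex ey ew D D'.
  exact: (wcomm_induced HC _ _ hf hg hh ha ex ey ew).
- move=> Z hZ X X' Y Y' A A' f g alpha x y x' y' z z' zz zz'.
  move=> /nes hf /nes hg /nes ha ex ey D D'.
  have hid : strong_epi (idm Z).
    by apply: iso_strong; exists (idm Z); rewrite comp_id_l.
  apply: (wcomm_induced HC _ _ hf hg hid ha ex ey).
  (* With zero weights, both sides of the weight square are zero morphisms. *)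
  by apply: zero_mor_unique; [apply: zero_mor_r | apply: zero_mor_l].
- move=> X X' Y Y' A A' f g alpha x y x' y'.
  move=> /nes hf /nes hg /nes ha ex ey D D'.
  apply: (wcomm_induced HC _ _ hf hg ha ha ex ey).
  by rewrite comp_id_l comp_id_r.
Qed.
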